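(* Let $W\in\mathbb{R}^{n\times n}$ be symmetric positive definite, let $T\in\mathbb{R}^{n\times n}$ be symmetric, indefinite and nonsingular, and let $A=W+\mathrm{i}T$. Let $\xi_1,\dots,\xi_n$ be the (real, nonzero) eigenvalues of $T^{-1}W$, and put $$\xi_{\max}^{-}=\min\{\xi_i:\xi_i<0\},\qquad \xi_{\max}^{+}=\max\{\xi_i:\xi_i>0\},\qquad \Theta=(\xi_{\max}^{-})^{-1}+(\xi_{\max}^{+})^{-1}.$$ Suppose that $\xi_{\max}^{-}\in(-1,0)$ and that, in case $\xi_{\max}^{+}>1$, also $\xi_{\max}^{-}\xi_{\max}^{+}>-1$. For $\alpha>0$ such that $\alpha T+W$ is nonsingular, let $G(T;\alpha)=(1+\mathrm{i}\alpha)T^{-1}W(\alpha T+W)^{-1}T$, whose spectral radius is $\rho(G(T;\alpha))=\sqrt{1+\alpha^{2}}\max_{1\le i\le n}\frac{|\xi_i|}{|\alpha+\xi_i|}$. Then the parameter $$\alpha_{T}^{*}=\begin{cases}+\infty,&\Theta\ge 0,\\ \max\left\{(\xi_{\max}^{+})^{-1},\,-2\Theta^{-1}\right\},&\Theta<0,\end{cases}$$ minimizes $\rho(G(T;\alpha))$ over all $\alpha>0$ with $\alpha T+W$ nonsingular (where, for $\Theta\ge0$, this means that $\lim_{\alpha\to+\infty}\rho(G(T;\alpha))$ equals the infimum of $\rho(G(T;\alpha))$ over these $\alpha$), and the PLHSS iteration with $V=T$ and parameter $\alpha_{T}^{*}$ converges to the solution of $Ax=b$ for all $b\in\mathbb{C}^n$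 and all initial vectors $x^{(0)}\in\mathbb{C}^n$.
   Context: A real symmetric matrix is indefinite if it has at least one positive and at least one negative eigenvalue. $T^{-1}W$ is similar to the symmetric matrix $W^{1/2}T^{-1}W^{1/2}$, so its eigenvalues are real and both signs occur. The PLHSS iteration with $V=T$ and finite parameter $\alpha>0$ for $Ax=b$ is, for $k=0,1,2,\dots$, $$(\alpha T+W)x^{(k+1/2)}=(\alpha-\mathrm{i})Tx^{(k)}+b,\qquad Tx^{(k+1)}=\mathrm{i}Wx^{(k+1/2)}-\mathrm{i}b,$$ with iteration matrix $G(T;\alpha)$. For $\alpha=+\infty$ it is understood as the limiting scheme $x^{(k+1/2)}=x^{(k)}$, $Tx^{(k+1)}=\mathrm{i}Wx^{(k)}-\mathrm{i}b$, with iteration matrix $\lim_{\alpha\to+\infty}G(T;\alpha)=\mathrm{i}T^{-1}W$. *)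

(* Defs.v *)
From HB Require Import structures.
From mathcomp Require Import all_boot all_order all_algebra.
From mathcomp Require Import all_classical all_reals all_analysis.
From mathcomp Require Import complex.

Set Implicit Arguments.
Unset Strict Implicit.
Unset Printing Implicit Defensive.

Import Order.TTheory GRing.Theory Num.Theory numFieldNormedType.Exports.
Local Open Scope classical_set_scope.
Local Open Scope ring_scope.
Local Open Scope complex_scope.

Section RealMatrices.
Context (R : realType) (n : nat).
Implicit Types (A T W : 'M[R]_n) (xi : 'I_n -> R).

Definition symposdef W : Prop :=
  W^T = W /\ forall x : 'cV[R]_n, x != 0 -> 0 < (x^T *m W *m x) 0 0.

Definition symindefinite T : Prop :=
  T^T = T /\ exists a b : R, [/\ eigenvalue T a, eigenvalue T b, 0 < a & b < 0].

(* [xi] lists the eigenvalues of [A] with algebraic multiplicity; see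
   [spectrum_invmxM_exists] for the existence of such a real list. *)
Definition spectrum_of A xi : Prop :=
  char_poly A = \prod_(i < n) ('X - (xi i)%:P).

(* The neutral element 0 is returned only when no [xi i] has the right sign. *)
Definition xi_neg xi : R := \big[Num.min/0]_(i < n | xi i < 0) xi i.
Definition xi_pos xi : R := \big[Num.max/0]_(i < n | 0 < xi i) xi i.

Definition Theta xi : R := (xi_neg xi)^-1 + (xi_pos xi)^-1.

Definition alpha_opt xi : \bar R :=
  if 0 <= Theta xi then +oo%E
  else (Num.max (xi_pos xi)^-1 (- 2 / Theta xi))%:E.

Definition admissible W T : set R :=
  [set alpha | 0 < alpha /\ alpha *: T + W \in unitmx].

End RealMatrices.

Section ComplexMatrices.
Context (R : realType) (n : nat).
Implicit Types (W T : 'M[R]_n).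

Definition cmx m p (A : 'M[R]_(m, p)) : 'M[R[i]]_(m, p) :=
  map_mx (real_complex R) A.

Definition Amx W T : 'M[R[i]]_n := cmx W + 'i%C *: cmx T.

Definition spectral_radius (A : 'M[R[i]]_n) : R :=
  sup [set ComplexField.Normc.normc z | z in [set z | eigenvalue A z]].

Definition Gmx W T (alpha : R) : 'M[R[i]]_n :=
  (1 +i* alpha) *: cmx (invmx T *m W *m invmx (alpha *: T + W) *m T).

(* One step [x |-> x'] of the PLHSS iteration with V = T; [xh] is the
   half-step iterate.  The parameter -oo is meaningless. *)
Definition plhss_step W T (alpha : \bar R) (b x xh x' : 'cV[R[i]]_n) : Prop :=
  match alpha with
  | a%:E%E => cmx (a *: T + W) *m xh = (a +i* (- 1)) *: (cmx T *m x) + b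
            /\ cmx T *m x' = 'i%C *: (cmx W *m xh) - 'i%C *: b
  | +oo%E => xh = x /\ cmx T *m x' = 'i%C *: (cmx W *m x) - 'i%C *: b
  | -oo%E => False
  end.

Definition plhss_run W T (alpha : \bar R) (b x0 : 'cV[R[i]]_n)
    (x : nat -> 'cV[R[i]]_n) : Prop :=
  x 0%N = x0 /\ forall k, exists xh, plhss_step W T alpha b (x k) xh (x k.+1).

(* The topology on C^n comes from the [numFieldType] structure of [R[i]]. *)
Definition cvg_cvec (x : nat -> 'cV[R[i]]_n) (l : 'cV[R[i]]_n) : Prop :=
  (x : nat -> 'cV[(R[i] : numFieldType)]_n) @ \oo
    --> (l : 'cV[(R[i] : numFieldType)]_n).

Definition plhss_converges W T (alpha : \bar R) : Prop :=
  forall b x0 : 'cV[R[i]]_n,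
    (exists x, plhss_run W T alpha b x0 x) /\
    (forall x, plhss_run W T alpha b x0 x -> cvg_cvec x (invmx (Amx W T) *m b)).

Definition minimizes_radius W T (alpha : \bar R) : Prop :=
  match alpha with
  | a%:E%E => admissible W T a /\
      forall c, admissible W T c ->
        spectral_radius (Gmx W T a) <= spectral_radius (Gmx W T c)
  | +oo%E => spectral_radius (Gmx W T a) @[a --> +oo%R] -->
      inf [set spectral_radius (Gmx W T c) | c in admissible W T]
  | -oo%E => False
  end.

Lemma cmx_sesqui_real W (u : 'rV[R[i]]_n) : W^T = W ->
  (u *m cmx W *m (map_mx (@conjc R) u)^T) 0 0 =
  ((map_mx (@complex.Re R) u *m W *m (map_mx (@complex.Re R) u)^T
    + map_mx (@complex.Im R) u *m W *m (map_mx (@complex.Im R) u)^T) 0 0)%:C.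
Proof.
move=> symW; set a := map_mx _ u; set b := map_mx (@complex.Im R) u.
have Eu : u = cmx a + 'i%C *: cmx b.
  by apply/rowP=> j; rewrite !mxE {1}[u 0 j]complexE.
have Ec : map_mx (@conjc R) u = cmx a - 'i%C *: cmx b.
  apply/rowP=> j; rewrite !mxE; case: (u 0 j) => x y /=.
  by apply/eqP; rewrite eq_complex /= !(mul0r, mulr0, mul1r, mulr1, addr0, add0r, oppr0, subr0, sub0r) !eqxx.
have cross : a *m W *m b^T = b *m W *m a^T.
  transitivity (a *m W *m b^T)^T; last by rewrite !trmx_mul trmxK symW mulmxA.
  by apply/matrixP=> i j; rewrite !ord1 [RHS]mxE.
have trc (m p : nat) (B : 'M[R]_(m, p)) : (cmx B)^T = cmx B^T by rewrite /cmx map_trmx.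
rewrite Ec {1}Eu linearB linearZ /= !trc !mulmxDl -!scalemxAl !mulmxBr.
rewrite -!scalemxAr scalerBr scalerA -expr2 sqr_i scaleN1r opprK.
rewrite /cmx -!map_mxM cross.
by rewrite !mxE rmorphD /= addrA subrK.
Qed.

Lemma spectrum_invmxM_exists W T : symposdef W -> T^T = T -> T \in unitmx ->
  exists xi : 'I_n -> R, spectrum_of (invmx T *m W) xi.
Proof.
move=> [symW posW] symT unitT.
set p := char_poly (invmx T *m W).
have pm : p \is monic by exact: char_poly_monic.
have [r Er] := closed_field_poly_normal (map_poly (real_complex R) p).
have lc1 : lead_coef (map_poly (real_complex R) p) = 1.
  by apply/eqP; rewrite -monicE monic_map.
rewrite lc1 scale1r in Er.
have realr z : z \in r -> z = (complex.Re z)%:C.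
  move=> rz.
  have : root (map_poly (real_complex R) p) z by rewrite Er root_prod_XsubC.
  rewrite /p map_char_poly -eigenvalue_root_char => /eigenvalueP[v Ev v0].
  pose u := v *m cmx (invmx T).
  have uT : u *m cmx T = v by rewrite -mulmxA -map_mxM mulVmx // map_mx1 mulmx1.
  have uW : u *m cmx W = z *: (u *m cmx T).
    by rewrite uT -Ev map_mxM mulmxA.
  clearbody u.
  have := congr1 (fun m => (m *m (map_mx (@conjc R) u)^T) 0 0) uW.
  rewrite /= -scalemxAl [RHS]mxE !cmx_sesqui_real //.
  set w := (X in X%:C = _); set t := (X in _ = _ * X%:C).
  have w0 : w != 0.
    have u0 : u != 0 by apply: contra_neq v0 => u0; rewrite -uT u0 mul0mx.
    have ge0 (x : 'rV[R]_n) : 0 <= (x *m W *m x^T) 0 0 ?= iff (x == 0).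
      case: eqVneq => [->|x0]; first by rewrite !mul0mx mxE; apply: leif_refl.
      have := posW x^T; rewrite trmx_eq0 trmxK => /(_ x0) h.
      by split; [exact: ltW h | exact: lt_eqF h].
    rewrite /w mxE eq_sym.
    have /= := (leifD (ge0 (map_mx (@complex.Re R) u)) (ge0 (map_mx (@complex.Im R) u))).2.
    rewrite addr0 => ->; apply: contra_neqN u0 => /andP[/eqP ra /eqP rb].
    apply/rowP=> j; have := congr1 (fun m : 'rV[R]_n => m 0 j) ra.
    have := congr1 (fun m : 'rV[R]_n => m 0 j) rb.
    by rewrite !mxE; case: (u 0 j) => /= ? ? -> ->.
  move=> E; have t0 : t != 0 by apply: contra_neq w0 => t0;
    apply: (fmorph_inj (real_complex R)); rewrite /= E t0 mulr0.
  have -> : z = (w / t)%:C.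
    by rewrite rmorphM fmorphV /= E mulfK // fmorph_eq0.
  by [].
have Ep : p = \prod_(z <- [seq complex.Re z | z <- r]) ('X - z%:P).
  apply: (map_poly_inj (real_complex R)); rewrite Er rmorph_prod big_map /=.
  by apply: eq_big_seq => z /realr Ez; rewrite rmorphB /= map_polyX map_polyC /= -Ez.
have szr : size [seq complex.Re z | z <- r] = n.
  by have := size_char_poly (invmx T *m W); rewrite -/p Ep size_prod_XsubC => -[].
exists (fun i => [seq complex.Re z | z <- r]`_i).
by rewrite /spectrum_of -/p Ep (big_nth 0) szr big_mkord.
Qed.

End ComplexMatrices.

(* Main.v *)
(* Diagonalizing [W] and then the Hermitian matrix congruent to [T^-1] yields an
   invertible [X] with [W = X^* X] and [X T^-1 X^* = diag xi]; hence
   [T^-1 W = X^-1 diag(xi) X], and [X^-1 . X] also diagonalizes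
   [T^-1 (alpha T + W)], [T^-1 A], [G(T; alpha)] and [i T^-1 W]. The spectral
   radius formula and the convergence of the iteration are thus read off the
   moduli of [(1 + i alpha) xi_i / (alpha + xi_i)] or [i xi_i].

   With [mu = - xi_neg] and [p = xi_pos], put
     [g(a) = sqrt(1 + a^2) mu / (a - mu)], [h(a) = sqrt(1 + a^2) p / (a + p)].
   The radius is at least 1 on [(0, mu)] and equals [max (g a) (h a)] beyond
   [mu].  There [g] decreases to [mu], while [h] decreases up to [1 / p] and
   increases afterwards; [g <= h] holds exactly from
   [- 2 / Theta = 2 mu p / (p - mu)] on if [mu < p], and never if [p <= mu].
   The bound [mu p < 1] given by the hypotheses makes the optimal value
   smaller than 1. *)
Require Import Defs.
From HB Require Import structures.
From mathcomp Require Import all_boot all_order all_algebra.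
From mathcomp Require Import all_classical all_reals all_analysis.
From mathcomp Require Import complex ring lra.
From mathcomp Require Import sesquilinear spectral.

Set Implicit Arguments.
Unset Strict Implicit.
Unset Printing Implicit Defensive.

Import Order.TTheory GRing.Theory Num.Theory numFieldNormedType.Exports.
Local Open Scope ring_scope.
Import Num.Def.
Local Open Scope sesquilinear_scope.
Local Open Scope complex_scope.

(** * Simultaneous diagonalization by congruence *)

Lemma eigenvalue_diagonalized (F : fieldType) n (X : 'M[F]_n) (d : 'rV[F]_n) a :
  X \in unitmx ->
  reflect (exists j, a = d 0 j) (eigenvalue (invmx X *m diag_mx d *m X) a).
Proof.
move=> uX; apply: (iffP eigenvalueP) => [[v Ev v0]|[j ->]].
  have y0 : v *m invmx X != 0.
    by apply: contra_neq v0 => v0; rewrite -(mulmxKV uX v) v0 mul0mx.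
  have Ey : v *m invmx X *m diag_mx d = a *: (v *m invmx X).
    by rewrite scalemxAl -Ev !mulmxA mulmxK.
  case/rV0Pn: y0 => j yj; exists j; apply: (mulfI yj).
  by have /rowP/(_ j) := Ey; rewrite mul_mx_diag mxE [RHS]mxE => ->; rewrite mulrC.
(* Eigenvectors are row vectors here, so row [j] of [X] serves for [d 0 j]. *)
exists (delta_mx 0 j *m X); last first.
  apply/negP => /eqP /(congr1 (mulmx^~ (invmx X))); rewrite mulmxK // mul0mx.
  by move=> /rowP/(_ j); rewrite !mxE !eqxx => /eqP; rewrite oner_eq0.
rewrite !mulmxA mulmxK // scalemxAl; congr (_ *m _).
apply/rowP => k; rewrite mul_mx_diag !mxE eqxx /=.
by case: eqVneq => [->|]; rewrite ?mulr1 ?mul1r ?mulr0 ?mul0r.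
Qed.

Lemma trmxC_mul (C : numClosedFieldType) m n p (A : 'M[C]_(m, n))
    (B : 'M[C]_(n, p)) : (A *m B)^t* = B^t* *m A^t*.
Proof. by rewrite trmx_mul map_mxM. Qed.

(** The square root of the spectral form of [W] gives [W = Q^* Q]. A unitary [U] diagonalizing the
    Hermitian [Q H Q^*] leaves this factorization intact, so [X = U Q] does both. *)
Lemma congruence_diagonalization (C : numClosedFieldType) n (W H : 'M[C]_n) :
  W \is hermsymmx -> H \is hermsymmx ->
  (forall u : 'rV[C]_n, u != 0 -> 0 < (u *m W *m u^t*) 0 0) ->
  exists X (d : 'rV[C]_n),
    [/\ X \in unitmx, W = X^t* *m X & X *m H *m X^t* = diag_mx d].
Proof.
move=> hW hH posW.
have /hermitian_normalmx /orthomx_spectralP EW := hW.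
set P := spectralmx W in EW; set w := spectral_diag W in EW.
have uP : P \is unitarymx by exact: spectral_unitarymx.
have PP : P *m P^t* = 1%:M by apply/unitarymxP.
rewrite invmx_unitary // in EW.
have ED : P *m W *m P^t* = diag_mx w.
  by rewrite EW !mulmxA PP mul1mx -mulmxA PP mulmx1.
have w_gt0 j : 0 < w 0 j.
  (* The eigenvalues of [W] are the values of its form at the rows of [P], hence positive. *)
  have rE (A : 'M[C]_n) : (row j P *m A *m (row j P)^t*) 0 0 = (P *m A *m P^t*) j j.
    rewrite -row_mul !mxE; apply: eq_bigr => k _; by rewrite !mxE.
  have r0 : row j P != 0.
    apply/negP => /eqP r0; have := rE 1%:M.
    rewrite r0 mulmx1 !mul0mx mulmx1 PP !mxE eqxx => /esym/eqP.
    by rewrite oner_eq0.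
  by have := posW _ r0; rewrite rE ED mxE eqxx.
pose DS := diag_mx (map_mx sqrtC w).
have DSt : DS^t* = DS.
  rewrite /DS tr_diag_mx map_diag_mx; congr diag_mx; apply/rowP => j.
  by rewrite !mxE; apply: conj_Creal; rewrite realE sqrtC_ge0 ltW ?w_gt0.
have DS2 : DS *m DS = diag_mx w.
  rewrite mulmx_diag; congr diag_mx; apply/rowP => j.
  by rewrite !mxE -expr2 sqrtCK.
pose Q := DS *m P.
have QW : Q^t* *m Q = W.
  by rewrite /Q trmxC_mul DSt mulmxA -(mulmxA _ DS DS) DS2 -EW.
have uQ : Q \in unitmx.
  rewrite unitmx_mul (unitarymx_unit uP) andbT unitmxE det_diag unitfE.
  by apply/prodf_neq0 => j _; rewrite mxE sqrtC_eq0 gt_eqF.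
clearbody Q; pose K := Q *m H *m Q^t*.
have hK : K \is hermsymmx.
  apply/is_hermitianmxP; rewrite expr0 scale1r !trmxC_mul trmxCK /K mulmxA.
  by have := is_hermitianmxP _ _ _ hH; rewrite expr0 scale1r => <-.
have /hermitian_normalmx /orthomx_spectralP EK := hK.
set U := spectralmx K in EK; set d := spectral_diag K in EK.
have uU : U \is unitarymx by exact: spectral_unitarymx.
have UU : U *m U^t* = 1%:M by apply/unitarymxP.
rewrite invmx_unitary // in EK.
exists (U *m Q), d; split.
- by rewrite unitmx_mul unitarymx_unit.
- rewrite trmxC_mul mulmxA -(mulmxA _ _ U) -(invmx_unitary uU).
  by rewrite mulVmx ?unitarymx_unit // mulmx1.
- rewrite trmxC_mul -!mulmxA (mulmxA Q) (mulmxA (Q *m H)) -/K EK.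
  by rewrite !mulmxA UU mul1mx -mulmxA UU mulmx1.
Qed.

Lemma cmx_hermsym (R : realType) n (A : 'M[R]_n) :
  A^T = A -> cmx A \is hermsymmx.
Proof.
move=> symA; apply/is_hermitianmxP; rewrite expr0 scale1r -{1}symA.
by apply/matrixP => i j; rewrite !mxE conj_Creal // complex_real.
Qed.

(** The form at [u] is the sum of the real forms at its real and imaginary parts, one of which is
    nonzero. *)
Lemma cmx_posdef (R : realType) n (W : 'M[R]_n) (u : 'rV[R[i]]_n) :
  symposdef W -> u != 0 -> 0 < (u *m cmx W *m u^t*) 0 0.
Proof.
move=> [symW posW] u0.
have -> : u^t* = (map_mx (@conjc R) u)^T by rewrite map_trmx.
rewrite cmx_sesqui_real // ltcR.
have ge0 (x : 'rV[R]_n) : x != 0 -> 0 < (x *m W *m x^T) 0 0.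
  by move=> x0; have := posW x^T; rewrite trmxK trmx_eq0; exact.
rewrite mxE; set a := map_mx _ u; set b := map_mx _ u.
have [a0|a0] := eqVneq a 0; last first.
  rewrite ltr_pwDl ?ge0 //; have [->|/ge0/ltW//] := eqVneq b 0.
  by rewrite !mul0mx mxE.
rewrite a0 !mul0mx [X in X + _]mxE add0r ge0 //; apply: contra_neq u0 => b0.
apply/rowP => j; have /rowP/(_ j) := a0; have /rowP/(_ j) := b0.
by rewrite !mxE; case: (u 0 j) => x y /= -> ->.
Qed.

Lemma eigenvalue_spectrum (R : realType) n (A : 'M[R]_n) (xi : 'I_n -> R) z :
  spectrum_of A xi -> reflect (exists i, z = (xi i)%:C) (eigenvalue (cmx A) z).
Proof.
move=> hxi; rewrite eigenvalue_root_char /cmx -map_char_poly hxi rmorph_prod.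
rewrite rootE horner_prod; apply: (iffP (prodf_eq0 _ _)) => [[i _]|[i ->]].
  rewrite rmorphB /= map_polyX map_polyC !hornerE subr_eq0 => /eqP ->.
  by exists i.
by exists i; rewrite // rmorphB /= map_polyX map_polyC !hornerE subrr.
Qed.

(** The diagonal [d] of the congruence and [xi] both consist of the eigenvalues of [T^-1 W]; this
    makes [d] real. The two lists are matched as sets, and a maximum over a list depends only on its
    set of values. *)
Lemma spectrum_congruence (R : realType) n (W T : 'M[R]_n) (xi : 'I_n -> R) :
  symposdef W -> T^T = T -> T \in unitmx -> spectrum_of (invmx T *m W) xi ->
  exists X (s : 'I_n -> R),
    [/\ X \in unitmx,
        cmx (invmx T *m W) = invmx X *m diag_mx (\row_j (s j)%:C) *m X,
        X *m cmx (invmx T) *m X^t* = diag_mx (\row_j (s j)%:C) &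
        range s = range xi].
Proof.
move=> hW symT uT hxi.
have symV : (invmx T)^T = invmx T by rewrite trmx_inv symT.
have [X [d [uX EW EV]]] := congruence_diagonalization (cmx_hermsym hW.1)
  (cmx_hermsym symV) (fun u => cmx_posdef hW (u := u)).
have ES : cmx (invmx T *m W) = invmx X *m diag_mx d *m X.
  by rewrite -EV !mulmxA mulVmx // mul1mx /cmx map_mxM -/(cmx W) EW !mulmxA.
have dE z : (exists i, z = (xi i)%:C) <-> exists j, z = d 0 j.
  split.
    by move/(eigenvalue_spectrum z hxi); rewrite ES => /eigenvalue_diagonalized; exact.
  by move/(eigenvalue_diagonalized d z uX); rewrite -ES => /eigenvalue_spectrum; exact.
pose s j := complex.Re (d 0 j).
have sE j : d 0 j = (s j)%:C.
  by have [_ /(_ (ex_intro _ j erefl))[i Ei]] := dE (d 0 j); rewrite /s Ei.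
have Ed : d = \row_j (s j)%:C by apply/rowP => j; rewrite mxE.
exists X, s; rewrite -Ed; split=> //.
apply/seteqP; split=> _ [i _ <-].
  by have [_ /(_ (ex_intro _ i erefl))[k]] := dE (d 0 i); rewrite sE => -[->]; exists k.
by have [/(_ (ex_intro _ i erefl))[k]] := dE (xi i)%:C; rewrite sE => -[->]; exists k.
Qed.

(* If no [xi i] were positive, the congruence would make [invmx T] negative
   semidefinite, against an eigenvector of [T] for a positive eigenvalue. *)
Lemma spectrum_has_pos (R : realType) n (W T : 'M[R]_n) (xi : 'I_n -> R) :
  symposdef W -> symindefinite T -> T \in unitmx ->
  spectrum_of (invmx T *m W) xi -> exists i, 0 < xi i.
Proof.
move=> hW [symT [a [_ [/eigenvalueP[v Ev v0] _ a0 _]]]] uT hxi.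
have [X [s [uX _ EV rs]]] := spectrum_congruence hW symT uT hxi.
apply: contrapT => /forallNP npos.
have s_le0 j : s j <= 0.
  have : range xi (s j) by rewrite -rs; exists j.
  by case=> i _ <-; rewrite leNgt; exact/negP.
have Xt : X^t* \in unitmx by rewrite map_unitmx unitmx_tr.
pose u := cmx v *m invmx X.
have uE : cmx v = u *m X by rewrite mulmxKV.
have q_le0 : (cmx v *m cmx (invmx T) *m (cmx v)^t*) 0 0 <= 0.
  rewrite uE trmxC_mul !mulmxA -(mulmxA u X) -(mulmxA u) EV mul_mx_diag mxE.
  apply: sumr_le0 => j _; rewrite !mxE mulrAC mulr_ge0_le0 ?mul_conjC_ge0 //.
  by rewrite lecR.
have vV : v *m invmx T = a^-1 *: v.
  have Ev' : v = a *: (v *m invmx T) by rewrite scalemxAl -Ev mulmxK.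
  by rewrite {2}Ev' scalerA mulVf ?scale1r // gt_eqF.
have : (cmx v *m cmx (invmx T) *m (cmx v)^t*) 0 0
     = (a^-1 * \sum_j v 0 j ^+ 2)%:C.
  rewrite /cmx -map_mxM vV map_mxZ -scalemxAl mxE mxE rmorphM /= rmorph_sum.
  congr (_ * _); apply: eq_bigr => j _; rewrite !mxE conj_Creal.
    by rewrite -rmorphM.
  by rewrite complex_real.
move=> E; move: q_le0; rewrite E lecR pmulr_rle0 ?invr_gt0 //.
apply/negP; rewrite -ltNge lt_def sumr_ge0 ?andbT => [|? _]; last exact: sqr_ge0.
apply: contra v0 => /eqP/psumr_eq0P z; apply/eqP/rowP => j; rewrite mxE.
by apply/eqP; rewrite -sqrf_eq0 z // => ? _; exact: sqr_ge0.
Qed.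

(** * The matrices of the iteration in a common eigenbasis *)

(** For a fixed invertible [X] these matrices form a commutative algebra with entrywise operations
    on [g], so matrix identities become scalar ones. *)
Definition cdiag (F : fieldType) n (X : 'M[F]_n) (g : 'I_n -> F) : 'M[F]_n :=
  invmx X *m diag_mx (\row_j g j) *m X.

Section ConjugatedDiagonal.
Context (F : fieldType) (n : nat) (X : 'M[F]_n).
Hypothesis uX : X \in unitmx.

Lemma cdiagM g h : cdiag X g *m cdiag X h = cdiag X (fun j => g j * h j).
Proof.
rewrite /cdiag !mulmxA mulmxK // -(mulmxA (invmx X) (diag_mx _)) mulmx_diag.
congr (_ *m diag_mx _ *m _); by apply/rowP => j; rewrite !mxE.
Qed.

Lemma cdiagZ a g : a *: cdiag X g = cdiag X (fun j => a * g j).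
Proof.
rewrite /cdiag scalemxAl scalemxAr; do 2!congr (_ *m _).
by apply/matrixP => i j; rewrite !mxE mulrnAr.
Qed.

Lemma cdiagD g h : cdiag X g + cdiag X h = cdiag X (fun j => g j + h j).
Proof.
rewrite /cdiag -mulmxDl -mulmxDr -linearD /=; congr (_ *m diag_mx _ *m _).
by apply/rowP => j; rewrite !mxE.
Qed.

Lemma cdiag_const a : cdiag X (fun=> a) = a%:M.
Proof.
have E : \row_(j < n) a = const_mx a by apply/rowP => j; rewrite !mxE.
by rewrite /cdiag E diag_const_mx mul_mx_scalar -scalemxAl mulVmx // scalemx1.
Qed.

Lemma cdiagX (v : nat -> 'cV[F]_n) g :
  (forall k, v k.+1 = cdiag X g *m v k) ->
  forall k, v k = cdiag X (fun j => g j ^+ k) *m v 0.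
Proof.
move=> Ev; elim=> [|k IHk]; first by rewrite cdiag_const mul1mx.
rewrite Ev IHk mulmxA cdiagM; congr (cdiag _ _ *m _).
by apply/funext => j; rewrite exprS.
Qed.

Lemma cdiag_unit g : (forall j, g j != 0) -> cdiag X g \in unitmx.
Proof.
move=> g0; rewrite /cdiag !unitmx_mul unitmx_inv uX andbT /=.
rewrite unitmxE det_diag unitfE.
by apply/prodf_neq0 => j _; rewrite mxE.
Qed.

Lemma cdiag_unitP g : cdiag X g \in unitmx -> forall j, g j != 0.
Proof.
rewrite /cdiag !unitmx_mul unitmx_inv uX andbT /= => + j.
by rewrite unitmxE det_diag unitfE => /prodf_neq0/(_ j isT); rewrite mxE.
Qed.

End ConjugatedDiagonal.

Section PLHSS.
Context (R : realType) (n : nat) (W T : 'M[R]_n) (X : 'M[R[i]]_n) (s : 'I_n -> R).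
Hypothesis uT : T \in unitmx.
Hypothesis uX : X \in unitmx.
Hypothesis ES : cmx (invmx T *m W) = cdiag X (fun j => (s j)%:C).

(** This is [T^-1 (a T + W) = a + T^-1 W]; the factor [T] stays outside because [X] diagonalizes
    only the product. *)
Lemma shifted_cdiag (a : R) :
  cmx (a *: T + W) = cmx T *m cdiag X (fun j => (a + s j)%:C).
Proof.
have -> : cdiag X (fun j => (a + s j)%:C)
   = cdiag X (fun j => a%:C + (s j)%:C).
  by congr cdiag; apply/funext => j; rewrite rmorphD.
rewrite -cdiagD -ES cdiag_const // -map_scalar_mx -/(cmx _) /cmx -map_mxD -map_mxM.
by rewrite mulmxDr mul_mx_scalar mulmxA mulmxV // mul1mx.
Qed.

Lemma admissibleP a : admissible W T a <-> 0 < a /\ forall j, a + s j != 0.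
Proof.
rewrite /admissible /= -(map_unitmx (real_complex R)) -/(cmx _) shifted_cdiag.
rewrite unitmx_mul map_unitmx uT /=; split=> -[a0 H]; split=> //.
  by move=> j; have := cdiag_unitP uX H j; rewrite fmorph_eq0.
by apply: cdiag_unit => // j; rewrite fmorph_eq0.
Qed.

Lemma Amx_cdiag : Amx W T = cmx T *m cdiag X (fun j => (s j) +i* 1).
Proof.
have -> : cdiag X (fun j => (s j) +i* 1) = cdiag X (fun j => (s j)%:C + 'i).
  by congr cdiag; apply/funext => j; rewrite [LHS]complexE mulr1.
rewrite -cdiagD -ES cdiag_const // mulmxDr mul_mx_scalar.
by rewrite /Amx /cmx -map_mxM mulmxA mulmxV // mul1mx.
Qed.

(** The diagonal factors [s j + i] have imaginary part 1 and cannot vanish. *)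
Lemma Amx_unit : Amx W T \in unitmx.
Proof.
rewrite Amx_cdiag unitmx_mul map_unitmx uT; apply: cdiag_unit => // j.
by rewrite eq_complex /= oner_eq0 andbF.
Qed.

Lemma shifted_inv a : admissible W T a ->
  cmx (invmx (a *: T + W) *m T) = cdiag X (fun j => ((a + s j)^-1)%:C).
Proof.
move=> adm; have [_ nz] := (admissibleP a).1 adm.
have uD : cdiag X (fun j => (a + s j)%:C) \in unitmx.
  by apply: cdiag_unit => // j; rewrite fmorph_eq0.
have uTc : cmx T \in unitmx by rewrite map_unitmx.
(* Both sides are multiplied on the left by the diagonalized factor and by [T], whose product is
   [a T + W]; each then equals [T]. *)
apply: (can_inj (mulKmx uD)); apply: (can_inj (mulKmx uTc)).
rewrite (cdiagM uX _ (fun j => ((a + s j)^-1)%:C)) mulmxA.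
apply: etrans (congr1 (mulmx^~ (cmx _)) (esym (shifted_cdiag a))) _.
have -> : (fun j => (a + s j)%:C * ((a + s j)^-1)%:C) = fun=> 1.
  by apply/funext => j; rewrite -rmorphM divff.
rewrite (cdiag_const uX) mulmx1 /cmx -map_mxM mulmxA (mulmxV adm.2).
by rewrite mul1mx.
Qed.

Lemma Gmx_cdiag a : admissible W T a ->
  Gmx W T a = cdiag X (fun j => (1 +i* a) * (s j / (a + s j))%:C).
Proof.
move=> adm; rewrite /Gmx -mulmxA /cmx map_mxM -!/(cmx _) (shifted_inv adm) ES.
rewrite (cdiagM uX) cdiagZ; congr cdiag; apply/funext => j.
by rewrite -rmorphM.
Qed.


Lemma spectral_radius_cdiag g :
  (0 < n)%N ->
  spectral_radius (cdiag X g)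
  = \big[Num.max/0]_(j < n) ComplexField.Normc.normc (g j).
Proof.
move=> n0; rewrite /spectral_radius; set E := [set _ | _ in _]%classic.
have EE z : E z <-> exists j, z = ComplexField.Normc.normc (g j).
  split=> [[w /= /eigenvalue_diagonalized] + <-|[j ->]].
    by move=> /(_ uX)[j ->]; exists j; rewrite mxE.
  exists (g j) => //=; apply/eigenvalue_diagonalized => //.
  by exists j; rewrite mxE.
have ubE : ubound E (\big[Num.max/0]_(j < n) ComplexField.Normc.normc (g j)).
  by move=> z /EE[j ->]; apply: le_bigmax.
have E0 : (E !=set0)%classic.
  by exists (ComplexField.Normc.normc (g (Ordinal n0))); apply/EE; exists (Ordinal n0).
have supE : has_sup E by split=> //; eexists; exact: ubE.
(* The seed 0 of the maximum must also lie below the supremum; any modulus in the nonempty set [E]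
   shows this. *)
apply/eqP; rewrite eq_le ge_sup //=; apply/bigmax_leP; split=> [|j _].
  have [z Ez] := E0; apply: le_trans (sup_upper_bound supE Ez).
  by case/EE: Ez => j ->; case: (g j) => x y /=; exact: sqrtr_ge0.
by apply: (sup_upper_bound supE); apply/EE; exists j.
Qed.

Lemma spectral_radius_Gmx (xi : 'I_n -> R) a :
  range s = range xi -> (0 < n)%N -> admissible W T a ->
  spectral_radius (Gmx W T a)
  = Num.sqrt (1 + a ^+ 2) * \big[Num.max/0]_(i < n) (`|xi i| / `|a + xi i|).
Proof.
move=> rs n0 adm; rewrite (Gmx_cdiag adm) spectral_radius_cdiag //.
have nE j : ComplexField.Normc.normc ((1 +i* a) * (s j / (a + s j))%:C)
    = Num.sqrt (1 + a ^+ 2) * (`|s j| / `|a + s j|).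
  rewrite ComplexField.Normc.normcM /= expr1n expr0n addr0 sqrtr_sqr.
  by rewrite normrM normfV.
under eq_bigr do rewrite nE.
have c0 : 0 < Num.sqrt (1 + a ^+ 2) by rewrite sqrtr_gt0 ltr_wpDr ?sqr_ge0.
(* Since [s] and [xi] share only their range, the two maxima are compared by bounding each term of
   one by a term of the other. *)
apply/eqP; rewrite eq_le; apply/andP; split.
  apply/bigmax_leP; split=> [|j _].
    by rewrite (mulr_ge0 (ltW c0)) //; apply: bigmax_ge_id.
  rewrite (ler_pM2l c0); have : range xi (s j) by rewrite -rs; exists j.
  by case=> i _ <-; exact: (le_bigmax 0 (fun i => `|xi i| / `|a + xi i|)).
rewrite mulrC -ler_pdivlMr //; apply/bigmax_leP; split=> [|i _].
  by rewrite divr_ge0 ?(ltW c0) //; apply: bigmax_ge_id.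
rewrite ler_pdivlMr // mulrC.
have : range s (xi i) by rewrite rs; exists i.
case=> j _ <-.
exact: (le_bigmax 0 (fun j => Num.sqrt (1 + a ^+ 2) * (`|s j| / `|a + s j|))).
Qed.

End PLHSS.

(** * Scalar minimization of the radius *)

(** A quotient with [a + xi i = 0] counts as 0 by the convention for division; admissibility
    excludes such [a]. *)
Definition radius (R : realType) n (xi : 'I_n -> R) (a : R) : R :=
  Num.sqrt (1 + a ^+ 2) * \big[Num.max/0]_(i < n) (`|xi i| / `|a + xi i|).

Section ExtremeEigenvalues.
Context (R : realType) (n : nat) (xi : 'I_n -> R).

Lemma xi_neg_le i : xi_neg xi < 0 -> xi_neg xi <= xi i.
Proof.
move=> neg; case: (ltP (xi i) 0) => [xi0|]; first exact: bigmin_le_cond.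
exact/le_trans/ltW.
Qed.

Lemma xi_neg_attained : xi_neg xi < 0 -> exists i, xi i = xi_neg xi.
Proof.
rewrite {1}/xi_neg => /bigmin_ltP[|[i xi0 _]]; first by rewrite ltxx.
by rewrite /xi_neg (bigmin_eq_arg 0 i) // => [|j /ltW //]; eexists.
Qed.

Lemma xi_pos_attained : (exists i, 0 < xi i) ->
  0 < xi_pos xi /\ exists i, xi i = xi_pos xi.
Proof.
move=> [i xi0]; split; first exact: lt_le_trans (le_bigmax_cond _ _ xi0).
by rewrite /xi_pos (bigmax_eq_arg 0 i) // => [|j /ltW //]; eexists.
Qed.

Lemma xi_pos_ge i : (exists i, 0 < xi i) -> xi i <= xi_pos xi.
Proof.
move=> /xi_pos_attained[pos _]; case: (ltP 0 (xi i)) => [xi0|xi0].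
  exact: le_bigmax_cond.
exact/(le_trans xi0)/ltW.
Qed.

End ExtremeEigenvalues.

(** Turns monotonicity of [g] and [h] into a polynomial inequality, whose two sides differ by the
    product in [sqrt_ratio_identity]. *)
Lemma sqrt_ratio_le (R : rcfType) (k a c u v : R) : 0 <= k -> 0 < u -> 0 < v ->
  (1 + a ^+ 2) * v ^+ 2 <= (1 + c ^+ 2) * u ^+ 2 ->
  Num.sqrt (1 + a ^+ 2) * (k / u) <= Num.sqrt (1 + c ^+ 2) * (k / v).
Proof.
move=> k0 u0 v0 le_sq.
have p1 (x : R) : 0 <= 1 + x ^+ 2 by rewrite addr_ge0 ?sqr_ge0.
have : Num.sqrt (1 + a ^+ 2) * v <= Num.sqrt (1 + c ^+ 2) * u.
  rewrite -ler_sqr ?nnegrE ?mulr_ge0 ?sqrtr_ge0 ?(ltW u0) ?(ltW v0) //.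
  by rewrite !exprMn !sqr_sqrtr ?p1.
move=> le; rewrite mulrCA [leRHS]mulrCA ler_wpM2l //.
by rewrite ler_pdivrMr // mulrAC ler_pdivlMr.
Qed.

(* With [p := - mu] this also compares the functions [mu / (a - mu)]. *)
Lemma sqrt_ratio_identity (R : comRingType) (p a c : R) :
  (1 + c ^+ 2) * (a + p) ^+ 2 - (1 + a ^+ 2) * (c + p) ^+ 2
  = (c - a) * ((a * p - 1) * (c + p) + (c * p - 1) * (a + p)).
Proof. ring. Qed.

Section Radius.
Context (R : realType) (n : nat) (xi : 'I_n -> R) (mu p : R).
Hypothesis mu01 : 0 < mu < 1.
Hypothesis p0 : 0 < p.
Hypothesis xi_ge : forall i, - mu <= xi i.
Hypothesis xi_le : forall i, xi i <= p.
Hypothesis xi_mu : exists i, xi i = - mu.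
Hypothesis xi_p : exists i, xi i = p.

(* The moduli of the factors of the extreme eigenvalues [- mu] and [p]; for
   [mu < a] the radius is the larger of the two. *)
Let g a := Num.sqrt (1 + a ^+ 2) * (mu / (a - mu)).
Let h a := Num.sqrt (1 + a ^+ 2) * (p / (a + p)).

Lemma radius_ge_h a : 0 < a -> h a <= radius xi a.
Proof.
move=> a0; rewrite ler_wpM2l ?sqrtr_ge0 //; have [i Ei] := xi_p.
have := le_bigmax 0 (fun i => `|xi i| / `|a + xi i|) i.
by rewrite Ei !gtr0_norm ?addr_gt0.
Qed.

Lemma radius_ge_g a : mu < a -> g a <= radius xi a.
Proof.
move=> a0; rewrite ler_wpM2l ?sqrtr_ge0 //; have [i Ei] := xi_mu.
have := le_bigmax 0 (fun i => `|xi i| / `|a + xi i|) i.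
by rewrite Ei normrN !gtr0_norm ?subr_gt0 //; case/andP: mu01.
Qed.

(** Already the factor of [- mu] is large: [mu / (mu - a) >= 1] and the square root is at least
    1. *)
Lemma radius_ge1 a : 0 < a < mu -> 1 <= radius xi a.
Proof.
move=> /andP[a0 amu]; have [i Ei] := xi_mu.
rewrite -[1]mulr1 ler_pM //.
  by rewrite -[leLHS]sqrtr1 ler_wsqrtr // lerDl sqr_ge0.
apply: le_trans (le_bigmax 0 (fun i => `|xi i| / `|a + xi i|) i).
rewrite Ei normrN gtr0_norm ?(lt_trans a0) // ltr0_norm ?subr_lt0 // opprB.
by rewrite ler_pdivlMr ?subr_gt0 // mul1r gerBl ltW.
Qed.

(** For [mu < a], the function [|x| / (a + x)] decreases on [[- mu, 0]] and increases on [[0, p]],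
    so its maximum is at an endpoint. *)
Lemma radius_le a b : mu < a -> g a <= b -> h a <= b -> radius xi a <= b.
Proof.
move=> mua; have [mu0 mu1] := andP mu01.
have c0 : 0 < Num.sqrt (1 + a ^+ 2) by rewrite sqrtr_gt0 ltr_wpDr ?sqr_ge0.
have a0 : 0 < a by exact: lt_trans mua.
have E x : (Num.sqrt (1 + a ^+ 2) * x <= b) = (x <= b / Num.sqrt (1 + a ^+ 2)).
  by rewrite ler_pdivlMr // mulrC.
rewrite /radius /g /h !E => gb hb.
have b0 : 0 <= b / Num.sqrt (1 + a ^+ 2).
  by apply: le_trans hb; rewrite divr_ge0 ?ltW // addr_gt0.
apply/bigmax_leP; split=> // i _.
case: (leP 0 (xi i)) => xi0.
  have d0 : 0 < a + xi i by rewrite ltr_pwDl.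
  apply: le_trans hb; rewrite (ger0_norm xi0) (gtr0_norm d0) ler_pdivrMr //.
  rewrite mulrAC ler_pdivlMr ?addr_gt0 // !mulrDr [p * xi i]mulrC lerD2r mulrC.
  by rewrite [leRHS]mulrC ler_wpM2l // ltW.
apply: le_trans gb; have := xi_ge i => ge.
have d0 : 0 < a + xi i by lra.
rewrite ltr0_norm // gtr0_norm // ler_pdivrMr // mulrAC ler_pdivlMr ?subr_gt0 //.
by nra.
Qed.

Lemma h_mono a c : 1 <= a * p -> 0 < a <= c -> h a <= h c.
Proof.
move=> ap /andP[a0 ac]; have c0 : 0 < c by exact: lt_le_trans ac.
have cp : 1 <= c * p by rewrite (le_trans ap) // ler_wpM2r // ltW.
apply: sqrt_ratio_le; rewrite ?(ltW p0) ?(addr_gt0 _ p0) //.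
rewrite -subr_ge0 sqrt_ratio_identity.
by rewrite mulr_ge0 ?subr_ge0 // addr_ge0 // mulr_ge0 ?subr_ge0 // ltW // addr_gt0.
Qed.

(** At [a = 1 / p] the difference in [sqrt_ratio_identity] is [(c - 1 / p)^2 p (1 / p + p)],
    nonnegative on either side of [1 / p]. *)
Lemma h_min c : 0 < c -> h p^-1 <= h c.
Proof.
move=> c0; have q0 : 0 < p^-1 by rewrite invr_gt0.
apply: sqrt_ratio_le; rewrite ?(ltW p0) ?(addr_gt0 _ p0) //.
rewrite -subr_ge0 sqrt_ratio_identity.
have qp : p^-1 * p = 1 by rewrite mulVf ?gt_eqF.
have -> : c * p - 1 = (c - p^-1) * p by rewrite mulrBl qp.
rewrite qp subrr mul0r add0r mulrA mulrA mulr_ge0 ?(ltW (addr_gt0 q0 p0)) //.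
by rewrite mulr_ge0 ?(ltW p0) // -expr2 sqr_ge0.
Qed.

Lemma g_anti a c : mu < a <= c -> g c <= g a.
Proof.
move=> /andP[mua ac]; have [mu0 mu1] := andP mu01.
have muc : mu < c by exact: lt_le_trans ac.
apply: sqrt_ratio_le; rewrite ?(ltW mu0) ?subr_gt0 //.
rewrite -subr_ge0 sqrt_ratio_identity.
have neg x : mu < x -> x * - mu - 1 <= 0 by nra.
rewrite mulr_le0 ?subr_le0 // -[leRHS]addr0.
by rewrite lerD // mulr_le0_ge0 ?neg // subr_ge0 ltW.
Qed.

(** The hypothesis is [h a < 1] squared, cleared of denominators and divided by [a]. *)
Lemma h_lt1 a : 0 < a -> a * (p ^+ 2 - 1) < 2 * p -> h a < 1.
Proof.
move=> a0 ap.
have ap0 : 0 < a + p by rewrite addr_gt0.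
rewrite /h mulrA ltr_pdivrMr // mul1r.
rewrite -ltr_sqr ?nnegrE ?mulr_ge0 ?sqrtr_ge0 ?(ltW p0) ?(ltW ap0) // exprMn.
rewrite sqr_sqrtr ?addr_ge0 ?sqr_ge0 // -subr_gt0.
have -> : (a + p) ^+ 2 - (1 + a ^+ 2) * p ^+ 2
    = a * (2 * p - a * (p ^+ 2 - 1)) by ring.
by rewrite mulr_gt0 // subr_gt0.
Qed.

(* The point where [g] and [h] cross. *)
Let a1 := 2 * mu * p / (p - mu).

(** At [a] the radius is at most [h a < 1], which settles [c < mu]. For [c > mu]: if [a = 1 / p],
    then [h a] is the global minimum of [h]; if [a = a1], then [h] grows to the right of [a], and to
    the left [g] is at least [g a = h a]. *)
Lemma radius_opt_finite a : mu < p -> mu * p < 1 -> a = Num.max p^-1 a1 ->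
  [/\ mu < a, radius xi a < 1 &
      forall c, 0 < c -> c != mu -> radius xi a <= radius xi c].
Proof.
move=> mup mup1 Ea; have [mu0 mu1] := andP mu01.
have d0 : 0 < p - mu by rewrite subr_gt0.
have q0 : 0 < p^-1 by rewrite invr_gt0.
have a1E : a1 * (p - mu) = 2 * mu * p by rewrite divfK // gt_eqF.
have mua1 : mu < a1 by rewrite ltr_pdivlMr //; nra.
have a1a : a1 <= a by rewrite Ea le_max lexx orbT.
have qa : p^-1 <= a by rewrite Ea le_max lexx.
have mua : mu < a by exact: lt_le_trans a1a.
have a0 : 0 < a by exact: lt_trans mua.
have a10 : 0 < a1 by exact: lt_trans mua1.
have radE : radius xi a <= h a.
  apply: radius_le => //; rewrite ler_wpM2l ?sqrtr_ge0 //.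
  rewrite ler_pdivrMr ?subr_gt0 // mulrAC ler_pdivlMr ?addr_gt0 //.
  (* Cross-multiplied, [g a <= h a] reads [2 mu p <= a (p - mu)]. *)
  have : a1 * (p - mu) <= a * (p - mu) by rewrite ler_wpM2r // ltW.
  by rewrite a1E; lra.
have lt1 : h a < 1.
  (* At [a1], after multiplication by [p - mu], the criterion has gap [2 p^2 (1 - mu p)]; at [1 / p]
     it reads [p - 1 / p < 2 p]. *)
  apply: h_lt1 => //; rewrite Ea; case: (leP p^-1 a1) => _.
    have pos : 0 < p * p * (1 - mu * p) by rewrite !mulr_gt0 // subr_gt0.
    by rewrite -(ltr_pM2r d0) mulrAC a1E; lra.
  have -> : p^-1 * (p ^+ 2 - 1) = p - p^-1 by field; rewrite gt_eqF.
  lra.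
split=> // [|c c0 cmu]; first exact: le_lt_trans lt1.
apply: le_trans radE _; have [lt_cmu|] := ltP c mu.
  by apply: le_trans (ltW lt1) (radius_ge1 _); rewrite c0.
rewrite le_eqVlt eq_sym (negPf cmu) /= => muc.
move: Ea; case: (leP p^-1 a1) => qa1 Ea; last first.
  by rewrite Ea; apply: le_trans (h_min c0) (radius_ge_h c0).
have [ca|ac] := leP c a; last first.
  apply: le_trans (radius_ge_h c0); apply: h_mono; last by rewrite a0 ltW.
  by rewrite -ler_pdivrMr // div1r.
have -> : h a = g a.
  have ap0 : a + p != 0 by rewrite gt_eqF // addr_gt0.
  have amu0 : a - mu != 0 by rewrite gt_eqF // subr_gt0.
  congr (_ * _); apply/eqP; rewrite eqr_div //.
  rewrite -subr_eq0.
  have -> : p * (a - mu) - mu * (a + p) = a * (p - mu) - 2 * mu * p by ring.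
  by rewrite Ea a1E subrr.
by apply: le_trans (radius_ge_g muc); apply: g_anti; rewrite muc.
Qed.

(** Beyond [mu], [sqrt (1 + c^2) >= c] gives [g c >= c mu / (c - mu) >= mu]; below [mu] the radius
    is at least 1. *)
Lemma radius_ge_mu c : 0 < c -> c != mu -> mu <= radius xi c.
Proof.
move=> c0 cmu; have [mu0 mu1] := andP mu01.
have [lt_cmu|] := ltP c mu.
  by apply: le_trans (ltW mu1) (radius_ge1 _); rewrite c0.
rewrite le_eqVlt eq_sym (negPf cmu) /= => muc.
have d0 : 0 < c - mu by rewrite subr_gt0.
apply: le_trans (radius_ge_g muc); apply: (@le_trans _ _ (c * (mu / (c - mu)))).
  by rewrite mulrA ler_pdivlMr // mulrC ler_wpM2r ?(ltW mu0) // gerBl ltW.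
rewrite ler_wpM2r ?divr_ge0 ?(ltW mu0) ?(ltW d0) //.
by rewrite -[leLHS](gtr0_norm c0) -sqrtr_sqr ler_wsqrtr // lerDr.
Qed.

(** For [p <= mu] the term [g] dominates, and [sqrt (1 + a^2) <= 1 + a] bounds it by a quantity
    tending to [mu]. *)
Lemma radius_near_mu a : p <= mu -> mu < a ->
  radius xi a <= mu + mu * (1 + mu) / (a - mu).
Proof.
move=> pmu mua; have [mu0 mu1] := andP mu01.
have a0 : 0 < a by exact: lt_trans mua.
have d0 : 0 < a - mu by rewrite subr_gt0.
have c0 : 0 <= Num.sqrt (1 + a ^+ 2) by exact: sqrtr_ge0.
have gb : g a <= mu + mu * (1 + mu) / (a - mu).
  have -> : mu + mu * (1 + mu) / (a - mu) = (1 + a) * (mu / (a - mu)).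
    by field; rewrite gt_eqF.
  rewrite ler_wpM2r ?divr_ge0 ?(ltW mu0) ?(ltW d0) //.
  rewrite -[leRHS]ger0_norm ?addr_ge0 ?(ltW a0) // -sqrtr_sqr ler_wsqrtr //.
  by rewrite sqrrD expr1n mul1r addrAC lerDl mulrn_wge0 // ltW.
apply: radius_le => //; apply: le_trans gb; rewrite ler_wpM2l //.
rewrite ler_pdivrMr ?addr_gt0 // mulrAC ler_pdivlMr //.
have : p * a <= mu * a by rewrite ler_wpM2r // ltW.
have : 0 < p * mu by rewrite mulr_gt0.
lra.
Qed.

End Radius.

(** * Error recursion and convergence of the iteration *)

(** Every entry of the error is at most [B * q ^+ k], where [q < 1] is the largest modulus of the
    factors and [B] collects the coefficients of [X^-1] applied to [X v]. *)
Lemma cvg_cdiag (R : realType) n (X : 'M[R[i]]_n) (g : 'I_n -> R[i])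
    (x : nat -> 'cV[R[i]]_n) (l v : 'cV[R[i]]_n) :
  (forall k, x k - l = cdiag X (fun j => g j ^+ k) *m v) ->
  (forall j, `|g j| < 1) -> cvg_cvec x l.
Proof.
move=> Ex g1.
pose q := \big[Num.max/0]_j complex.Re `|g j|.
have reN (z : R[i]) : `|z| = (complex.Re `|z|)%:C by case: z.
have q0 : 0 <= q by exact: bigmax_ge_id.
have q1 : q < 1.
  by apply/bigmax_ltP; split=> // j _; have := g1 j; rewrite reN ltcR.
have gq j : `|g j| <= q%:C by rewrite reN lecR; exact: (le_bigmax 0).
have [w Ew] : exists w, w = X *m v by eexists.
pose c i j := complex.Re `|invmx X i j * w j 0|.
pose B := \sum_i \sum_j c i j.
have c0 i j : 0 <= c i j by rewrite -lecR /c -reN; exact: normr_ge0.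
have bnd k i j : `|l i j - x k i j| <= (B * q ^+ k)%:C.
  have -> : `|l i j - x k i j| = `|(x k - l) i j| by rewrite distrC !mxE.
  rewrite Ex (ord1 j) -!mulmxA -Ew mxE.
  apply: (@le_trans _ _ (\sum_j (c i j * q ^+ k)%:C)).
    apply: le_trans (ler_norm_sum _ _ _) (ler_sum _ _) => m _.
    rewrite mul_diag_mx !mxE mulrCA mulrC normrM rmorphM /= -reN.
    by rewrite normrX rmorphXn ler_wpM2l // lerXn2r ?nnegrE // lecR.
  rewrite -rmorph_sum lecR -mulr_suml ler_wpM2r ?exprn_ge0 //.
  rewrite /B [leRHS](bigD1 i) //= lerDl sumr_ge0 // => m _.
  by rewrite sumr_ge0.
have lim0 : ((fun k => B * q ^+ k) @ \oo --> (0 : R))%classic.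
  by rewrite -(mulr0 B); apply: cvgMl_tmp; apply: cvg_expr; rewrite ger0_norm.
apply/cvg_ballP => e e0.
(* Ball radii live in [R[i]]; being positive, [e] is real, so the real limit [lim0] applies. *)
have eE : e = (complex.Re e)%:C by rewrite RRe_real // gtr0_real.
have e0' : 0 < complex.Re e by move: e0; rewrite {1}eE ltcR.
have /cvgr0_norm_lt /(_ _ e0') nr := lim0.
near=> k; split=> // i j; rewrite /ball /=; apply: le_lt_trans (bnd k i j) _.
rewrite eE ltcR; apply: le_lt_trans (ler_norm _) _.
by near: k.
Unshelve. all: by end_near.
Qed.

Section Iteration.
Context (R : realType) (n : nat) (W T : 'M[R]_n).
Hypothesis uT : T \in unitmx.

Let uTc : cmx T \in unitmx. Proof. by rewrite map_unitmx. Qed.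

Lemma plhss_converges_cdiag alpha (X : 'M[R[i]]_n) g :
  X \in unitmx -> (forall j, `|g j| < 1) ->
  (forall b x, exists x' xh, plhss_step W T alpha b x xh x') ->
  (forall b x xh x', plhss_step W T alpha b x xh x' ->
     x' - invmx (Amx W T) *m b = cdiag X g *m (x - invmx (Amx W T) *m b)) ->
  plhss_converges W T alpha.
Proof.
move=> uX g1 ex err b x0; split=> [|x [x00 run]].
  have [F HF] := choice (ex b); by exists (fun k => iter k F x0).
apply: (cvg_cdiag (X := X) (g := g) (v := x 0%N - invmx (Amx W T) *m b)) => // k.
apply: (cdiagX uX (v := fun k => x k - invmx (Amx W T) *m b)) => m.
by have [xh] := run m; exact: err.
Qed.

Section Error.
Variable b : 'cV[R[i]]_n.
Hypothesis uA : Amx W T \in unitmx.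
Let l := invmx (Amx W T) *m b.

Lemma rhs_solution : b = cmx W *m l + 'i *: (cmx T *m l).
Proof. by rewrite scalemxAl -mulmxDl mulKVmx. Qed.

(** With [b = W l + i T l], the term [- i b] equals [T l - i W l], so
    [T (x' - l) = i W (xh - l)]. *)
Lemma second_half_step_error (xh x' : 'cV[R[i]]_n) :
  cmx T *m x' = 'i *: (cmx W *m xh) - 'i *: b ->
  x' - l = 'i *: (cmx (invmx T *m W) *m (xh - l)).
Proof.
move=> Ex'; apply: (can_inj (mulKmx uTc)).
rewrite -scalemxAr mulmxA /cmx -map_mxM mulmxA mulmxV // mul1mx -/(cmx W) -/(cmx T).
rewrite mulmxBr Ex' {1}rhs_solution mulmxBr !scalerBr scalerDr scalerA.
by rewrite -expr2 sqr_i scaleN1r opprD opprK addrA addrK.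
Qed.

Lemma step_error_fin a (x xh x' : 'cV[R[i]]_n) : admissible W T a ->
  plhss_step W T a%:E b x xh x' -> x' - l = Gmx W T a *m (x - l).
Proof.
move=> adm [Exh /second_half_step_error ->].
have uD : cmx (a *: T + W) \in unitmx by rewrite map_unitmx adm.2.
(* Subtracting [(a T + W) l] from the first half-step leaves [(a - i) T (x - l)], because
   [b - (a T + W) l = - (a - i) T l]. *)
have -> : xh - l = (a +i* (- 1)) *: (cmx (invmx (a *: T + W) *m T) *m (x - l)).
  apply: (can_inj (mulKmx uD)).
  rewrite -scalemxAr mulmxA {2}/cmx -map_mxM mulmxA (mulmxV adm.2) mul1mx.
  rewrite -/(cmx T) mulmxBr Exh {1}rhs_solution mulmxBr scalerBr -!addrA.
  congr (_ + _); rewrite /cmx map_mxD map_mxZ mulmxDl -scalemxAl.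
  have -> : a +i* (- 1) = a%:C - 'i.
    by apply/eqP; rewrite eq_complex /= oppr0 addr0 add0r !eqxx.
  rewrite scalerBl; set u := _ *: _; set w := cmx W *m l; set t := _ *: _.
  by rewrite opprD opprB addrCA (addrC (- t)) (addrA w) subrr add0r.
rewrite -scalemxAr scalerA mulmxA /cmx -map_mxM /Gmx -scalemxAl !mulmxA.
(* The scalars of the two half-steps combine as [i (a - i) = 1 + i a]. *)
congr (_ *: _); apply/eqP.
by rewrite eq_complex /= !mul0r !mul1r sub0r opprK add0r !eqxx.
Qed.

Lemma step_error_inf (x xh x' : 'cV[R[i]]_n) :
  plhss_step W T +oo%E b x xh x' ->
  x' - l = ('i *: cmx (invmx T *m W)) *m (x - l).
Proof. by move=> [_ /second_half_step_error ->]; rewrite scalemxAl. Qed.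

End Error.

Lemma step_exists_fin a b x : admissible W T a ->
  exists x' xh, plhss_step W T a%:E b x xh x'.
Proof.
move=> adm; have uD : cmx (a *: T + W) \in unitmx by rewrite map_unitmx adm.2.
by do 2!eexists; split; [exact: mulKVmx|exact: mulKVmx].
Qed.

Lemma step_exists_inf b x : exists x' xh, plhss_step W T +oo%E b x xh x'.
Proof. by do 2!eexists; split; [reflexivity|exact: mulKVmx]. Qed.

End Iteration.

(** * Minimality among admissible parameters and convergence at the optimum *)

Section Optimality.
Context (R : realType) (n : nat) (W T : 'M[R]_n) (xi : 'I_n -> R) (mu p : R).
Hypothesis mu01 : 0 < mu < 1.
Hypothesis p0 : 0 < p.
Hypothesis xi_ge : forall i, - mu <= xi i.
Hypothesis xi_le : forall i, xi i <= p.
Hypothesis xi_mu : exists i, xi i = - mu.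
Hypothesis xi_p : exists i, xi i = p.
Hypothesis admP : forall a, admissible W T a <-> 0 < a /\ forall i, a + xi i != 0.
Hypothesis srE : forall a, admissible W T a ->
  spectral_radius (Gmx W T a) = radius xi a.

Lemma admissible_gt_mu a : mu < a -> admissible W T a.
Proof.
move=> mua; apply/admP; have [mu0 _] := andP mu01; split; first exact: lt_trans mua.
by move=> i; rewrite gt_eqF //; have := xi_ge i; lra.
Qed.

Lemma admissible_neq_mu a : admissible W T a -> 0 < a /\ a != mu.
Proof.
move=> /admP[a0 nz]; split=> //; have [i Ei] := xi_mu.
by have := nz i; rewrite Ei subr_eq0.
Qed.

Lemma minimizes_radius_fin a : mu < p -> mu * p < 1 ->
  a = Num.max p^-1 (2 * mu * p / (p - mu)) ->
  minimizes_radius W T a%:E /\ spectral_radius (Gmx W T a) < 1.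
Proof.
move=> mup mup1 Ea.
have [mua lt1 opt] := radius_opt_finite mu01 p0 xi_ge xi_le xi_mu xi_p mup mup1 Ea.
have adm := admissible_gt_mu mua.
split; last by rewrite (srE adm).
split; [exact: adm | move=> c admc; rewrite (srE adm) (srE admc)].
by have [c0 cmu] := admissible_neq_mu admc; exact: opt.
Qed.

(** The value [mu] bounds all radii from below and is approached as [a] grows, so it is both the
    infimum and the limit. *)
Lemma minimizes_radius_inf : p <= mu -> minimizes_radius W T +oo%E.
Proof.
move=> pmu; have [mu0 mu1] := andP mu01.
set E := [set spectral_radius (Gmx W T c) | c in admissible W T]%classic.
have lbE : lbound E mu.
  move=> _ [c admc <-]; rewrite (srE admc).
  by have [c0 cmu] := admissible_neq_mu admc; exact: radius_ge_mu.
(* The threshold makes the remainder [mu (1 + mu) / (a - mu)] of [radius_near_mu] at most [e]. *)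
have near_mu e a : 0 < e -> mu + mu * (1 + mu) / e <= a ->
    admissible W T a /\ spectral_radius (Gmx W T a) <= mu + e.
  move=> e0 ea; have k0 : 0 < mu * (1 + mu) by rewrite mulr_gt0 ?addr_gt0.
  have mua : mu < a by apply: lt_le_trans ea; rewrite ltrDl divr_gt0.
  have adm := admissible_gt_mu mua; split; [exact: adm | rewrite (srE adm)].
  apply: le_trans (radius_near_mu mu01 p0 xi_ge xi_le pmu mua) _.
  rewrite lerD2l ler_pdivrMr ?subr_gt0 // [leRHS]mulrC -ler_pdivrMr //.
  by rewrite lerBrDl.
have infE : inf E = mu.
  apply/eqP; rewrite eq_le; apply/andP; split.
    apply/ler_addgt0Pr => e e0; have [adm le] := near_mu e _ e0 (lexx _).
    by apply: le_trans le; apply: ge_inf; [exists mu|exists (mu + mu * (1 + mu) / e)].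
  apply: lb_le_inf lbE; have adm := admissible_gt_mu (ltr_pwDr ltr01 (lexx mu)).
  by exists (spectral_radius (Gmx W T (mu + 1))); exists (mu + 1).
rewrite /minimizes_radius -/E infE; apply/cvgrPdist_le => e e0; near=> a.
have [|adm le] := near_mu e a e0.
  by near: a; apply: nbhs_pinfty_ge; exact: num_real.
have ge : mu <= spectral_radius (Gmx W T a) by apply: lbE; exists a.
by rewrite distrC ger0_norm ?subr_ge0 // lerBlDl.
Unshelve. all: by end_near.
Qed.

End Optimality.

Theorem theorem3p5 (R : realType) (n : nat) (W T : 'M[R]_n) (xi : 'I_n -> R)
    (hW : symposdef W) (hT : symindefinite T) (hTu : T \in unitmx)
    (hxi : spectrum_of (invmx T *m W) xi)
    (hneg : -1 < xi_neg xi < 0)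
    (hpos : 1 < xi_pos xi -> -1 < xi_neg xi * xi_pos xi) :
  [/\ forall alpha : R, admissible W T alpha ->
        spectral_radius (Gmx W T alpha)
        = Num.sqrt (1 + alpha ^+ 2)
          * \big[Num.max/0]_(i < n) (`|xi i| / `|alpha + xi i|),
      minimizes_radius W T (alpha_opt xi),
      Amx W T \in unitmx &
      plhss_converges W T (alpha_opt xi)].
Proof.
have [neg_gt neg0] := andP hneg.
have pos := spectrum_has_pos hW hT hTu hxi.
have [p0 xi_p] := xi_pos_attained pos.
have [k Ek] := xi_neg_attained neg0.
have n0 : (0 < n)%N by exact: leq_ltn_trans (ltn_ord k).
have [X [s [uX ES _ rs]]] := spectrum_congruence hW hT.1 hTu hxi.
have uA := Amx_unit hTu uX ES.
have xiP i : exists j, xi i = s j.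
  by have : range s (xi i) by [rewrite rs; exists i]; case=> j _ <-; exists j.
have sP j : exists i, s j = xi i.
  by have : range xi (s j) by [rewrite -rs; exists j]; case=> i _ <-; exists i.
have admP a : admissible W T a <-> 0 < a /\ forall i, a + xi i != 0.
  split=> [/(admissibleP hTu uX ES)[a0 nz]|[a0 nz]].
    by split=> // i; have [j ->] := xiP i.
  by apply/(admissibleP hTu uX ES); split=> // j; have [i ->] := sP j.
have srE a : admissible W T a -> spectral_radius (Gmx W T a) = radius xi a.
  exact: spectral_radius_Gmx hTu uX ES _ a rs n0.
have conv alpha g : (forall j, ComplexField.Normc.normc (g j) < 1) ->
    (forall b x, exists x' xh, plhss_step W T alpha b x xh x') ->
    (forall b x xh x', plhss_step W T alpha b x xh x' ->
       x' - invmx (Amx W T) *m b = cdiag X g *m (x - invmx (Amx W T) *m b)) ->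
    plhss_converges W T alpha.
  move=> g1; apply: plhss_converges_cdiag => // j.
  by rewrite (_ : `|g j| = (ComplexField.Normc.normc (g j))%:C) // ltcR.
pose mu := - xi_neg xi; set p := xi_pos xi in p0 xi_p hpos *.
have mu01 : 0 < mu < 1 by rewrite oppr_gt0 neg0 ltrNl.
have [mu0 mu1] := andP mu01.
have xi_ge i : - mu <= xi i by rewrite opprK xi_neg_le.
have xi_le i : xi i <= p by exact: xi_pos_ge.
have xi_mu : exists i, xi i = - mu by exists k; rewrite opprK.
(* For [p > 1] this is [hpos]; otherwise [mu p <= mu < 1]. *)
have mup1 : mu * p < 1.
  case: (ltP 1 p) => [/hpos|p1]; first by rewrite mulNr ltrNl.
  by apply: le_lt_trans mu1; rewrite ler_piMr // ltW.
have ThE : Theta xi = p^-1 - mu^-1 by rewrite /Theta /mu invrN opprK addrC.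
have ThS : (0 <= Theta xi) = (p <= mu) by rewrite ThE subr_ge0 lef_pV2.
clearbody mu; pose a := Num.max p^-1 (- 2 / Theta xi).
have fin : mu < p -> minimizes_radius W T a%:E /\ spectral_radius (Gmx W T a) < 1.
  move=> mup.
  apply: (minimizes_radius_fin mu01 p0 xi_ge xi_le xi_mu xi_p admP srE mup mup1).
  (* With [Theta = 1 / p - 1 / mu], the value [- 2 / Theta] is the crossing point
     [2 mu p / (p - mu)]. *)
  congr Num.max; rewrite ThE; field.
  by rewrite mulN1r !subr_eq0 [mu == p]lt_eqF // !gt_eqF.
split; [exact: srE | | exact: uA |]; rewrite /alpha_opt ThS; case: leP => [pmu|mup].
- exact: minimizes_radius_inf pmu.
- exact: (fin mup).1.
- apply: (conv _ (fun j => 'i * (s j)%:C)).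
  + move=> j; rewrite ComplexField.Normc.normcM /= !expr0n !addr0 !add0r expr1n.
    rewrite sqrtr1 mul1r sqrtr_sqr; have [i ->] := sP j.
    (* For [p <= mu] all eigenvalues lie in [[- mu, mu]], so the factors [i xi_i] have modulus at
       most [mu < 1]. *)
    apply: le_lt_trans mu1; rewrite ler_norml xi_ge (le_trans (xi_le i)) //.
  + by move=> b x; exact: step_exists_inf.
  + move=> b x xh x' /(step_error_inf hTu uA) ->.
    by rewrite ES -/(cdiag X (fun j => (s j)%:C)) cdiagZ.
- have [[adm _] sr1] := fin mup.
  apply: (conv _ (fun j => (1 +i* a) * (s j / (a + s j))%:C)).
  (* Each factor is bounded by the spectral radius at [a], already shown to be below 1. *)
  + move=> j; apply: le_lt_trans sr1.
    rewrite (Gmx_cdiag hTu uX ES adm) (spectral_radius_cdiag uX) //.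
    pose g j := (1 +i* a) * (s j / (a + s j))%:C.
    exact: (le_bigmax 0 (fun j => ComplexField.Normc.normc (g j))).
  + by move=> b x; exact: step_exists_fin.
  + move=> b x xh x' /(step_error_fin hTu uA adm) ->.
    by rewrite (Gmx_cdiag hTu uX ES adm).
Qed.
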